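(* Let $q\ge3$ be an odd prime power. For an $\operatorname{Aff}(\mathbb F_q)$-stable subset $X\subseteq\mathcal A$ define $$\operatorname{mass}(X)=\sum_{\mathcal O\in X/\operatorname{Aff}(\mathbb F_q)}\frac1{\#\operatorname{Stab}(\mathcal O)},\qquad N_{\mathrm{orb}}(X)=\#\bigl(X/\operatorname{Aff}(\mathbb F_q)\bigr),$$ $$N_{\mathrm{stab}}(X)=\#\{\mathcal O\in X/\operatorname{Aff}(\mathbb F_q):\operatorname{Stab}(\mathcal O)\ne1\},$$ where $\#\operatorname{Stab}(\mathcal O)$ is the order of the stabiliser of any element of the orbit $\mathcal O$. Then $\operatorname{mass}(X)=\#X/\#\operatorname{Aff}(\mathbb F_q)$, so $$\operatorname{mass}(\mathcal A)=(q-2)^2(q^2-q+4),\qquad \operatorname{mass}(\mathcal D)=(q-2)(q^2-3q+3),$$ $$\operatorname{mass}(\mathcal G_5)=3(q^3-6q^2+14q-13),\qquad \operatorname{mass}(\mathcal G_6)=q^4-9q^3+35q^2-71q+61,$$ and $\operatorname{mass}(\mathcal A)=\operatorname{mass}(\mathcal D)+\operatorname{mass}(\mathcal G_5)+\operatorname{mass}(\mathcal G_6)$. Moreover $$N_{\mathrm{orb}}(\mathcal A)=(q-2)^2(q^2-q+4)+(q-2)(q-3),\qquad N_{\mathrm{stab}}(\mathcal A)=2(q-2)(q-3),$$ and every orbit with nontrivial stabiliser lies in $\mathcal D$.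
   Context: For monic quadratics $u=x^2+u_1x+u_0$, $v=x^2+v_1x+v_0$, $w=x^2+w_1x+w_0$ in $\mathbb F_q[x]$ put $$\mathfrak d(u,v,w)=\det\begin{pmatrix} u_0 & u_1 & 1 \\ v_0 & v_1 & 1 \\ w_0 & w_1 & 1 \end{pmatrix}.$$ $\mathcal A$ is the set of ordered triples $(u,v,w)$ of monic quadratics over $\mathbb F_q$ that are separable and pairwise coprime. $\mathcal D=\{(u,v,w)\in\mathcal A:\mathfrak d(u,v,w)=0\}$; $\mathcal G_5$ is the set of $(u,v,w)\in\mathcal A$ with $\mathfrak d\neq0$ and at least one of $u_1=v_1$, $v_1=w_1$, $w_1=u_1$; $\mathcal G_6=\mathcal A\setminus(\mathcal D\cup\mathcal G_5)$. $\operatorname{Aff}(\mathbb F_q)=\{\alpha_{a,b}:x\mapsto ax+b : a\in\mathbb F_q^\times,\ b\in\mathbb F_q\}$, of order $q(q-1)$, acts on monic quadratics by $s\mapsto s^{\alpha}:=a^{-2}s(\alpha(x))$ (for $\alpha=\alpha_{a,b}$) and on triples componentwise; this action preserves $\mathcal A,\mathcal D,\mathcal G_5,\mathcal G_6$. *)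

(* Defs.v *)
From HB Require Import structures.
From mathcomp Require Export all_boot all_algebra all_fingroup all_field.

Set Implicit Arguments.
Unset Strict Implicit.
Unset Printing Implicit Defensive.

Import GRing.Theory.
Local Open Scope ring_scope.

Section AffineGroup.
Variable F : finFieldType.

(* [Aff a b] is the map x |-> a x + b.  The group law is composition,
   (g * h) x = g (h x), as opposed to the law of {perm F}, for which
   (g * h) x = h (g x); this makes s |-> s^g a right action. *)
Record aff := Aff { aff_a : {unit F}; aff_b : F }.

Definition pair_of_aff (g : aff) : {unit F} * F := (aff_a g, aff_b g).
Definition aff_of_pair (p : {unit F} * F) : aff := Aff p.1 p.2.
Lemma pair_of_affK : cancel pair_of_aff aff_of_pair.
Proof. by case. Qed.

HB.instance Definition _ := Finite.copy aff (can_type pair_of_affK).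

Definition aff_fun (g : aff) (x : F) : F := val (aff_a g) * x + aff_b g.

Definition aff_one : aff := Aff 1%g 0.
Definition aff_mul (g h : aff) : aff :=
  Aff (aff_a g * aff_a h)%g (aff_fun g (aff_b h)).
Definition aff_inv (g : aff) : aff :=
  Aff (aff_a g)^-1%g (- ((val (aff_a g))^-1 * aff_b g)).

Lemma aff_mulA : associative aff_mul.
Proof.
move=> [a b] [c d] [e f]; rewrite /aff_mul /aff_fun /=.
by rewrite mulgA mulrDr mulrA addrA.
Qed.

Lemma aff_mul1 : left_id aff_one aff_mul.
Proof. by move=> [a b]; rewrite /aff_mul /aff_fun /= mul1g mul1r addr0. Qed.

Lemma aff_mulV : left_inverse aff_one aff_inv aff_mul.
Proof. by move=> [a b]; rewrite /aff_mul /aff_fun /= mulVg subrr. Qed.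

HB.instance Definition _ := Finite_isGroup.Build aff aff_mulA aff_mul1 aff_mulV.

Lemma aff_funM (g h : aff) (x : F) : aff_fun (g * h)%g x = aff_fun g (aff_fun h x).
Proof. by rewrite /aff_fun /= mulrDr mulrA addrA. Qed.

Lemma aff_fun_inj (g h : aff) : aff_fun g =1 aff_fun h -> g = h.
Proof.
case: g h => [a b] [c d] e; move: (e 0) (e 1).
rewrite /aff_fun /= !mulr0 !add0r !mulr1 => -> /addIr ac.
by congr Aff; apply: val_inj.
Qed.

Lemma card_aff : #|[set: aff]| = (#|F| * #|F|.-1)%N.
Proof.
have bij : bijective pair_of_aff by exists aff_of_pair => [[]|[]].
rewrite cardsT (bij_eq_card bij) card_prod mulnC; congr (_ * _)%N.
by rewrite -cardsT card_finField_unit.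
Qed.

Definition aff_poly (g : aff) : {poly F} := val (aff_a g) *: 'X + (aff_b g)%:P.

End AffineGroup.

Section Quadratics.
Variable F : finFieldType.

Record mquad := MQuad {
  mquad_poly :> {poly F};
  _ : (mquad_poly \is monic) && (size mquad_poly == 3%N)
}.

HB.instance Definition _ := [isSub for mquad_poly].
HB.instance Definition _ := [Choice of mquad by <:].

Implicit Types u v w s : mquad.

Lemma quad_proof (c : F * F) :
  let p : {poly F} := 'X^2 + (c.2 *: 'X + c.1%:P) in (p \is monic) && (size p == 3%N).
Proof.
have szr : (size ((c.2 *: 'X + c.1%:P)%R : {poly F}) < size ('X^2 : {poly F}))%N.
  rewrite size_polyXn ltnS (leq_trans (size_polyD _ _)) // geq_max.
  rewrite (leq_trans (size_scale_leq _ _)) ?size_polyX //=.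
  by rewrite (leq_trans (size_polyC_leq1 _)).
by rewrite /= monicE lead_coefDl // lead_coefXn size_polyDl // size_polyXn !eqxx.
Qed.

Definition quad_of_coefs (c : F * F) : mquad := MQuad (quad_proof c).
Definition coefs_of_quad s : F * F := (s`_0, s`_1).

Lemma coefs_of_quadK : cancel coefs_of_quad quad_of_coefs.
Proof.
case=> p pP; apply: val_inj => /=; case/andP: pP => /monicP + /eqP sz.
rewrite lead_coefE sz /= => p2; apply/polyP=> i.
rewrite !coefE; case: i => [|[|[|i]]] //=.
- by rewrite mulr0 !add0r.
- by rewrite mulr1 addr0 add0r.
- by rewrite mulr0 !addr0.
- by rewrite mulr0 !addr0 nth_default // sz.
Qed.

HB.instance Definition _ : isCountable mquad := CanIsCountable coefs_of_quadK.
HB.instance Definition _ : isFinite mquad := CanIsFinite coefs_of_quadK.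

Lemma mquad_act_proof s (g : aff F) :
  let p := (val (aff_a g)) ^- 2 *: (s \Po aff_poly g) in
  (p \is monic) && (size p == 3%N).
Proof.
have a0 : val (aff_a g) != 0 by rewrite -unitfE; apply: (valP (aff_a g)).
have szb : (size (aff_b g)%:P < size (val (aff_a g) *: 'X))%N.
  by rewrite size_scale // size_polyX ltnS size_polyC_leq1.
have sz2 : size (aff_poly g) = 2%N by rewrite size_polyDl // size_scale // size_polyX.
have lc : lead_coef (aff_poly g) = val (aff_a g).
  by rewrite lead_coefDl // lead_coefZ lead_coefX mulr1.
case: s => p /= /andP[/monicP lp /eqP sz].
have szc : size (p \Po aff_poly g) = 3%N by rewrite size_comp_poly2 // sz2.
rewrite monicE lead_coefZ lead_coef_comp ?sz2 // lp lc sz /= mul1r.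
by rewrite mulVf ?expf_neq0 // eqxx size_scale ?szc // invr_eq0 expf_neq0.
Qed.

Definition mquad_act s (g : aff F) : mquad := MQuad (mquad_act_proof s g).

Lemma mquad_act1 s : mquad_act s 1%g = s.
Proof.
apply: val_inj; rewrite /= /aff_poly /= scale1r addr0 comp_polyXr.
by rewrite expr1n invr1 scale1r.
Qed.

Lemma mquad_actM s (g h : aff F) :
  mquad_act s (g * h)%g = mquad_act (mquad_act s g) h.
Proof.
apply: val_inj; rewrite /= comp_polyZ scalerA -invfM -exprMn mulrC.
rewrite -comp_polyA; congr (_ *: (_ \Po _)).
rewrite /aff_poly comp_polyD comp_polyZ comp_polyX comp_polyC.
by rewrite scalerDr scalerA -addrA scale_polyC -polyCD.
Qed.

Definition triple : finType := (mquad * mquad * mquad)%type.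

Definition triple_act (t : triple) (g : aff F) : triple :=
  let: (u, v, w) := t in (mquad_act u g, mquad_act v g, mquad_act w g).

Lemma triple_act1 t : triple_act t 1%g = t.
Proof. by case: t => [[u v] w] /=; rewrite !mquad_act1. Qed.

Lemma triple_actM t (g h : aff F) :
  triple_act t (g * h)%g = triple_act (triple_act t g) h.
Proof. by case: t => [[u v] w] /=; rewrite !mquad_actM. Qed.

Canonical aff_act := TotalAction triple_act1 triple_actM.

Definition dd u v w : F :=
  \det (\matrix_(i < 3, j < 3)
    (nth [::] [:: [:: u`_0; u`_1; 1];
                  [:: v`_0; v`_1; 1];
                  [:: w`_0; w`_1; 1]] i)`_j).

Definition calA : {set triple} :=
  [set t : triple | let: (u, v, w) := t in
    [&& separable_poly u, separable_poly v, separable_poly w,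
        coprimep u v, coprimep v w & coprimep w u]].

Definition calD : {set triple} :=
  [set t in calA | let: (u, v, w) := t in dd u v w == 0].

Definition calG5 : {set triple} :=
  [set t in calA | let: (u, v, w) := t in
    (dd u v w != 0) && [|| u`_1 == v`_1, v`_1 == w`_1 | w`_1 == u`_1]].

Definition calG6 : {set triple} := calA :\: (calD :|: calG5).

Definition aff_stable (X : {set triple}) : bool :=
  [acts [set: aff F], on X | aff_act].

Definition aff_orbits (X : {set triple}) : {set {set triple}} :=
  orbit aff_act [set: aff F] @: X.

(* #Stab(O), computed at a chosen element of O; see [stab_orderE]. *)
Definition stab_order (O : {set triple}) : nat :=
  if [pick t in O] is Some t then #|'C_[set: aff F][t | aff_act]%g| else 0%N.

Lemma stab_orderE (t0 t : triple) :
  t \in orbit aff_act [set: aff F] t0 ->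
  stab_order (orbit aff_act [set: aff F] t0)
    = #|'C_[set: aff F][t | aff_act]%g|.
Proof.
move=> tO; rewrite /stab_order; case: pickP => [t' t'O | /(_ t)]; last by rewrite tO.
have cardC z : z \in orbit aff_act [set: aff F] t0 ->
    (#|orbit aff_act [set: aff F] t0| * #|'C_[set: aff F][z | aff_act]%g|)%N
    = #|[set: aff F]|.
  by move=> /orbit_eqP <-; rewrite card_orbit_in_stab ?subsetT.
apply/eqP; have: (0 < #|orbit aff_act [set: aff F] t0|)%N.
  by apply/card_gt0P; exists t.
by move/eqn_pmul2l <-; rewrite !cardC.
Qed.

Definition mass (X : {set triple}) : rat :=
  \sum_(O in aff_orbits X) (stab_order O)%:R^-1.

Definition N_orb (X : {set triple}) : nat := #|aff_orbits X|.

Definition N_stab (X : {set triple}) : nat :=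
  #|[set O in aff_orbits X | stab_order O != 1%N]|.

End Quadratics.

Arguments calA F : clear implicits.
Arguments calD F : clear implicits.
Arguments calG5 F : clear implicits.
Arguments calG6 F : clear implicits.

(* Main.v *)
Require Import Defs.
From mathcomp Require Import cyclic ring zify.
Set Implicit Arguments.
Unset Strict Implicit.
Unset Printing Implicit Defensive.

Import GRing.Theory Num.Theory.
Local Open Scope ring_scope.

(** Everything is counted in the affine plane of monic quadratics
    x^2 + u_1 x + u_0, with coordinates (u_1, u_0).  Let q = 2h + 1.

    The masses are cardinals in disguise: by orbit-stabiliser an orbit O
    contributes #O / #Aff to the mass of X, and the orbits partition X
    ([mass_card]).

    Coprimality becomes combinatorial: two monic quadratics are coprime exactly
    when they differ and share no rational root ([coprimep_quad]).  So, given
    pairwise coprime separable quadratics of which a are split and b are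
    irreducible, the irreducible separable quadratics coprime to all of them are
    the irreducible ones not in the list, q h - b in number, and the split ones
    are the pairs of points of F outside the 2a roots already used, binomial
    (q - 2a, 2) in number ([sum_compatible]).  Applying this three times counts
    the triples of A ([card_calA]).

    The condition d(u, v, w) = 0 says that u, v, w are collinear.  A line of the
    plane is either vertical (u_1 constant) or of the form u(r) = e; the lines
    u(r) = 0 contain no two coprime quadratics, and on any other line coprime
    means distinct.  Hence a triple of D is a triple of distinct separable points
    of a vertical line (the set V, [card_calV]) or of a line u(r) = e with e
    nonzero (the set N, [card_calN]); such a line has q, q - 1 or q - 2 separable
    points, because the discriminant along it is a linear function or the
    polynomial b^2 - 4e.

    For G_5, at most one of the three equalities can hold off D, so it consists
    of three cyclic copies of T = {u_1 = v_1 <> w_1} ([card_calG5]).  The union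
    of T and V is the set of all triples of A with u_1 = v_1, which is again
    counted by [sum_compatible] because the count of the possible w depends only
    on the splitting types of u and v ([card_vertical_pairs]).

    For the stabilisers: x -> ax + b multiplies discriminants by a^-2, so it can
    fix a separable quadratic only if a = 1 or a = -1, and then it is the
    identity or the reflection x -> -x - u_1 exchanging the roots
    ([fixed_quad]).  A triple of A is thus stabilised by the identity alone,
    unless u_1 = v_1 = w_1, when the stabiliser has order 2.  The orbits with
    nontrivial stabiliser are therefore the orbits of V, which is contained in D,
    and both orbit counts follow from the mass of V. *)

(** * Monic quadratics by their coefficients *)

Section QuadraticAlgebra.
Variable F : finFieldType.
Implicit Types (u v w : mquad F) (g : aff F).

Lemma quad_of_coefsE (c : F * F) :
  ((quad_of_coefs c)`_0 = c.1) * ((quad_of_coefs c)`_1 = c.2).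
Proof. by split; rewrite /= !coefE /= ?mulr0 ?mulr1 ?addr0 !add0r. Qed.

Lemma quad_eq u v : u`_0 = v`_0 -> u`_1 = v`_1 -> u = v.
Proof. by move=> e0 e1; apply: (can_inj (@coefs_of_quadK F)); congr (_, _). Qed.

Lemma quad_polyE u : (u : {poly F}) = 'X^2 + (u`_1 *: 'X + (u`_0)%:P).
Proof. by rewrite -{1}(coefs_of_quadK u). Qed.

Lemma horner_quad u x : (u : {poly F}).[x] = x ^+ 2 + u`_1 * x + u`_0.
Proof. by rewrite {1}quad_polyE !hornerD hornerXn hornerZ hornerX hornerC addrA. Qed.

Definition disc u : F := u`_1 ^+ 2 - 4 * u`_0.

Definition rts u : {set F} := [set x | root u x].

Lemma in_rts u x : (x \in rts u) = (x ^+ 2 + u`_1 * x + u`_0 == 0).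
Proof. by rewrite inE rootE horner_quad. Qed.

(** The difference of two distinct monic quadratics is a nonzero constant or a
    multiple of some X - r; in the second case the only possible common factor
    is X - r, so a common factor always comes from a rational root. *)
Lemma coprimep_quad u v :
  coprimep u v = (u != v) && [disjoint rts u & rts v].
Proof.
have -> : (v : {poly F}) = 1 * (u : {poly F}) + ((v`_1 - u`_1) *: 'X + (v`_0 - u`_0)%:P).
  rewrite mul1r {1}(quad_polyE v) {1}(quad_polyE u) scalerBl polyCB; ring.
rewrite coprimep_addl_mul; have [e1|n1] := eqVneq u`_1 v`_1.
  rewrite e1 subrr scale0r add0r; have [->|nuv] := eqVneq u v.
    by rewrite subrr coprimep0 -size_poly_eq1; case: (v) => /= p /andP[_ /eqP ->].
  have n0 : v`_0 - u`_0 != 0.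
    by apply: contra nuv; rewrite subr_eq0 => /eqP e0; apply/eqP/quad_eq.
  rewrite -alg_polyC coprimepZr // coprimep1 /=; apply/esym/pred0P=> x /=.
  rewrite !in_rts e1; apply: contraNF n0 => /andP[/eqP eu /eqP ev].
  have -> : v`_0 - u`_0 = (x ^+ 2 + v`_1 * x + v`_0) - (x ^+ 2 + v`_1 * x + u`_0).
    by ring.
  by rewrite eu ev subrr.
have nuv : u != v by apply: contra n1 => /eqP->.
have n1' : v`_1 - u`_1 != 0 by rewrite subr_eq0 eq_sym.
(* r is the root of the difference v - u. *)
set r := (u`_0 - v`_0) / (v`_1 - u`_1).
have er : (v`_1 - u`_1) * r = u`_0 - v`_0 by rewrite /r mulrC divfK.
have -> : (v`_1 - u`_1) *: 'X + (v`_0 - u`_0)%:P = (v`_1 - u`_1) *: ('X - r%:P).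
  by rewrite scalerBr -(opprB u`_0) -er polyCN polyCM mul_polyC.
rewrite coprimepZr // coprimep_XsubC nuv /=; apply/idP/idP.
  move=> nr; apply/pred0P=> x /=; rewrite !in_rts; apply: contraNF nr => /andP[eu ev].
  suff -> : r = x by rewrite rootE horner_quad.
  apply: (mulfI n1'); rewrite er; apply/eqP; rewrite -subr_eq0; apply/eqP.
  transitivity ((x ^+ 2 + u`_1 * x + u`_0) - (x ^+ 2 + v`_1 * x + v`_0)).
    by ring.
  by rewrite (eqP eu) (eqP ev) subrr.
move=> /pred0P/(_ r)/= /negbT; rewrite !in_rts; apply: contra.
rewrite rootE horner_quad => eu; rewrite eu /=; apply/eqP.
transitivity ((r ^+ 2 + u`_1 * r + u`_0) + ((v`_1 - u`_1) * r - (u`_0 - v`_0))).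
  by ring.
by rewrite (eqP eu) er subrr addr0.
Qed.

Lemma aff_a_neq0 g : val (aff_a g) != 0.
Proof. by rewrite -unitfE; apply: (valP (aff_a g)). Qed.

Lemma act_coefs u g (a := val (aff_a g)) (b := aff_b g) :
  ((mquad_act u g)`_0 = (b ^+ 2 + u`_1 * b + u`_0) / a ^+ 2)
  * ((mquad_act u g)`_1 = (2 * b + u`_1) / a).
Proof.
have a0 : a != 0 := aff_a_neq0 g.
set p : {poly F} := mquad_act u g.
have -> : p = 'X^2 + (((2 * b + u`_1) / a) *: 'X
                + ((b ^+ 2 + u`_1 * b + u`_0) / a ^+ 2)%:P).
  rewrite /p /= {1}(quad_polyE u) /aff_poly -/a -/b.
  rewrite !comp_polyD comp_polyZ expr2 comp_polyM comp_polyX comp_polyC.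
  rewrite mulrDl !mulrDr -!scalerAl -!scalerAr -polyCM !mul_polyC -expr2.
  rewrite [_ * b%:P]mulrC mul_polyC; apply/polyP=> i; rewrite !coefE.
  have -> : FinRing.uval (aff_a g) = a by [].
  rewrite -/b; case: i => [|[|[|i]]] /=; by field.
by split; rewrite !coefE /= ?mulr0 ?mulr1 ?addr0 !add0r.
Qed.

Lemma disc_act u g : disc (mquad_act u g) = disc u / val (aff_a g) ^+ 2.
Proof.
have a0 := aff_a_neq0 g.
by rewrite /disc !act_coefs; field.
Qed.

Lemma act_rts u g x : (x \in rts (mquad_act u g)) = (aff_fun g x \in rts u).
Proof.
have a0 := aff_a_neq0 g.
rewrite !in_rts /aff_fun !act_coefs; set L := LHS.
have -> : L = ((val (aff_a g) ^+ 2)^-1 * ((val (aff_a g) * x + aff_b g) ^+ 2 +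
  u`_1 * (val (aff_a g) * x + aff_b g) + u`_0) == 0).
  by congr (_ == _); field.
by rewrite mulf_eq0 invr_eq0 expf_eq0 (negPf a0).
Qed.

Lemma dd_expand u v w :
  dd u v w = u`_0 * (v`_1 - w`_1) - u`_1 * (v`_0 - w`_0)
             + (v`_0 * w`_1 - v`_1 * w`_0).
Proof.
rewrite /dd (expand_det_row _ ord0) !big_ord_recl big_ord0 /cofactor.
rewrite !(expand_det_row _ ord0) !big_ord_recl !big_ord0 /cofactor !det_mx11.
by rewrite !mxE /= !expr0 !expr1 ?expr2; ring.
Qed.

End QuadraticAlgebra.

(** * Squares, separability and splitting in odd characteristic *)

Section OddCount.
Variable F : finFieldType.
Hypothesis odd_q : odd #|F|.
Implicit Types (u v w : mquad F) (g : aff F).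

Local Notation q := #|F|.
Local Notation h := (#|F|./2).

Lemma card_odd_field : q = (h * 2).+1.
Proof. by rewrite -[LHS]odd_double_half odd_q muln2. Qed.

(** The additive group of F has odd order q, hence q = 0 in F; were 2 zero as
    well, 1 would vanish. *)
Lemma two_neq0 : 2 != 0 :> F.
Proof.
apply/eqP=> two0.
have q0 : q%:R = 0 :> F.
  by have := expg_cardG (in_setT (1 : F)); rewrite FinRing.zmodXgE cardsT.
have := oner_neq0 F; rewrite -q0 card_odd_field -addn1 natrD natrM two0 mulr0.
by rewrite add0r eqxx.
Qed.

Lemma four_neq0 : 4 != 0 :> F.
Proof. by rewrite (_ : 4 = 2 * 2); [rewrite mulf_neq0 ?two_neq0 | ring]. Qed.

Definition sqrts (d : F) : {set F} := [set x | x ^+ 2 == d].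
Definition is_square d := sqrts d != set0.

Lemma card_sqrts d : d != 0 -> #|sqrts d| = (is_square d * 2)%N.
Proof.
move=> d0; rewrite /is_square; have [->|[x]] := set_0Vmem (sqrts d).
  by rewrite eqxx cards0.
rewrite inE => /eqP xd; have x0 : x != 0.
  by apply: contra d0 => /eqP x0; rewrite -xd x0 expr0n.
have -> : sqrts d = [set x; - x].
  by apply/setP=> y; rewrite !inE -xd eqf_sqr.
have nx : x != - x.
  rewrite -subr_eq0 opprK (_ : x + x = 2 * x); last by ring.
  by rewrite mulf_neq0 ?two_neq0.
by rewrite cards2 nx; case: eqP => // /setP/(_ x); rewrite !inE eqxx.
Qed.

(** Squaring maps the 2h nonzero elements two-to-one onto the nonzero squares. *)
Lemma card_squares : #|[set d | (d != 0) && is_square d]| = h.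
Proof.
have : (\sum_(d : F | d != 0%R) #|sqrts d| = h * 2)%N.
  transitivity (#|[set x : F | x != 0]|).
    rewrite -[RHS]sum1_card [RHS](partition_big (fun x => x ^+ 2) (fun d => d != 0)) /=.
      apply: eq_bigr => d d0; rewrite -sum1_card; apply: eq_bigl => x.
      rewrite !inE andbC; case: (x ^+ 2 =P d) => [xd|] //=.
      by rewrite -sqrf_eq0 xd d0.
    by move=> x; rewrite inE sqrf_eq0.
  have -> : [set x : F | x != 0] = [set~ 0] by apply/setP=> x; rewrite !inE.
  by rewrite cardsC1 {1}card_odd_field.
rewrite (eq_bigr (fun d => (is_square d * 2)%N)); last by move=> d; apply: card_sqrts.
rewrite -big_distrl /= => /eqP; rewrite eqn_pmul2r // => /eqP <-.
rewrite -sum1_card big_mkcond [RHS]big_mkcond; apply: eq_bigr => d _.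
by rewrite inE; case: (d != 0); case: is_square.
Qed.

Lemma card_nonsquares : #|[set d | (d != 0) && ~~ is_square d]| = h.
Proof.
have: #|[set~ (0 : F)]| = (h * 2)%N by rewrite cardsC1 {1}card_odd_field.
rewrite -(cardsID [set d | is_square d]) muln2 -addnn -{1}card_squares.
rewrite (_ : _ :&: _ = [set d | (d != 0) && is_square d]); last first.
  by apply/setP=> d; rewrite !inE.
move/addnI=> <-; congr #|pred_of_set _|.
by apply/setP=> d; rewrite !inE andbC.
Qed.

(** All counts below depend on an element only through a boolean type; summing an
    arbitrary function H of the type makes it possible to nest the counts. *)
Lemma sum_nonzero_by_square (H : bool -> nat) :
  (\sum_(d : F | d != 0%R) H (is_square d) = h * H true + h * H false)%N.
Proof.
rewrite (bigID is_square) /=; congr addn.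
  rewrite (eq_bigr (fun=> H true)) => [|d /andP[_ ->] //].
  by rewrite sum_nat_const -{1}card_squares cardsE.
rewrite (eq_bigr (fun=> H false)) => [|d /andP[_ /negPf->] //].
by rewrite sum_nat_const -{1}card_nonsquares cardsE.
Qed.

(** The derivative is 2 (X + u_1 / 2), and the value of u at -u_1 / 2 is
    -disc u / 4. *)
Lemma separable_quad u : separable_poly u = (disc u != 0).
Proof.
have u'E : (u : {poly F})^`() = 2 *: ('X - (- u`_1 / 2)%:P).
  rewrite scalerBr -alg_polyC scalerA mulrC divfK ?two_neq0 // scaleNr opprK.
  by rewrite {1}(quad_polyE u) !derivE addr0 scaler_nat.
rewrite separable_poly.unlock u'E coprimepZr ?two_neq0 // coprimep_XsubC.
rewrite rootE horner_quad; congr negb; set L := LHS.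
have -> : L = (- 4^-1 * disc u == 0).
  by rewrite /L /disc; congr (_ == _); field; rewrite two_neq0 four_neq0.
by rewrite mulf_eq0 oppr_eq0 invr_eq0 (negPf four_neq0).
Qed.

(** For a separable quadratic: being a product of two distinct linear factors. *)
Definition splits u := rts u != set0.

(** Completing the square: x -> 2x + u_1 sends the roots of u to the square roots
    of its discriminant. *)
Lemma card_rts_sqrts u : #|rts u| = #|sqrts (disc u)|.
Proof.
have bf : bijective (fun x => 2 * x + u`_1).
  exists (fun y => (y - u`_1) / 2) => y; field; exact: two_neq0.
transitivity #|(fun x => 2 * x + u`_1) @^-1: sqrts (disc u)|; last first.
  by apply: on_card_preimset; exact: onW_bij.
congr #|pred_of_set _|; apply/setP=> x; rewrite in_rts !inE -[RHS]subr_eq0.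
rewrite (_ : _ - _ = 4 * (x ^+ 2 + u`_1 * x + u`_0)); last by rewrite /disc; ring.
by rewrite mulf_eq0 (negPf four_neq0).
Qed.

Lemma splitsE u : splits u = is_square (disc u).
Proof. by rewrite /splits /is_square -!cards_eq0 card_rts_sqrts. Qed.

Lemma card_rts u : separable_poly u -> #|rts u| = (splits u * 2)%N.
Proof. by rewrite separable_quad splitsE card_rts_sqrts => /card_sqrts. Qed.

(** A separable split quadratic is the same thing as its two-element set of
    roots. *)
Lemma card_split_avoid (R : {set F}) :
  #|[set w : mquad F | [&& separable_poly w, splits w & [disjoint rts w & R]]]|
    = 'C(q - #|R|, 2).
Proof.
have -> : (q - #|R|)%N = #|~: R| by rewrite [RHS]cardsCs setCK.
rewrite -cards_draws -(card_in_imset (f := @rts F)).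
  congr #|pred_of_set _|; apply/setP=> A; rewrite inE -disjoints_subset.
  apply/imsetP/andP=> [[w + ->]|[AR /cards2P[a [b [ab defA]]]]].
    by rewrite inE => /and3P[sw cw dw]; rewrite dw card_rts // cw.
  pose w := quad_of_coefs (a * b, - (a + b)).
  have wA : rts w = A.
    apply/setP=> x; rewrite defA in_rts !inE !quad_of_coefsE /=.
    rewrite -!(subr_eq0 x) -mulf_eq0; congr (_ == _); ring.
  exists w => //; rewrite inE /splits wA AR andbT separable_quad /disc.
  rewrite !quad_of_coefsE /= (_ : _ - _ = (a - b) ^+ 2); last by ring.
  rewrite expf_eq0 subr_eq0 ab /=; apply/set0Pn; exists a.
  by rewrite defA !inE eqxx.
move=> u v; rewrite !inE => /and3P[su cu _] _ uv.
have /eqP/cards2P[a [b [ab rab]]] : #|rts u| = 2 by rewrite card_rts // cu.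
have common z : z \in rts u -> (u`_1 - v`_1) * z = v`_0 - u`_0.
  move=> zu; have zv := zu; rewrite uv in zv; move: zu zv.
  rewrite !in_rts => /eqP zu /eqP zv; apply/eqP; rewrite -subr_eq0; apply/eqP.
  transitivity ((z ^+ 2 + u`_1 * z + u`_0) - (z ^+ 2 + v`_1 * z + v`_0)); first by ring.
  by rewrite zu zv subrr.
have ea : (u`_1 - v`_1) * a = v`_0 - u`_0 by apply: common; rewrite rab set21.
have eb : (u`_1 - v`_1) * b = v`_0 - u`_0 by apply: common; rewrite rab set22.
have e1 : u`_1 = v`_1.
  apply/eqP; rewrite -subr_eq0 -[_ == 0]orbF -(negPf ab) -(subr_eq0 a b) -mulf_eq0.
  by rewrite mulrBr ea eb subrr.
apply: quad_eq => //; apply/eqP; rewrite -subr_eq0 -oppr_eq0 opprB -ea e1.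
by rewrite subrr mul0r.
Qed.

(** On a vertical line the discriminant is a bijective coordinate, and separable
    split quadratics correspond to its nonzero square values. *)
Lemma sum_vertical (c : F) (H : bool -> nat) :
  (\sum_(v : mquad F | separable_poly v && (v`_1 == c)%R) H (splits v)
    = h * H true + h * H false)%N.
Proof.
rewrite -sum_nonzero_by_square.
rewrite (reindex_onto (fun d => quad_of_coefs ((c ^+ 2 - d) / 4, c)) (@disc F)).
  have dE d : disc (quad_of_coefs ((c ^+ 2 - d) / 4, c)) = d.
    by rewrite /disc !quad_of_coefsE /=; field; exact: four_neq0.
  apply: eq_big => [d|d _]; last by rewrite splitsE dE.
  by rewrite separable_quad quad_of_coefsE dE /= !eqxx !andbT.
move=> v /andP[_ /eqP <-]; apply: quad_eq; rewrite quad_of_coefsE //= /disc.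
by field; exact: four_neq0.
Qed.

(** Along the line u(r) = e the derivative b = u'(r) = u_1 + 2r is a coordinate,
    in which the discriminant is b^2 - 4e. *)
Lemma card_line (r e : F) :
  #|[set u : mquad F | separable_poly u && ((u : {poly F}).[r] == e)]|
    = (q - #|sqrts (4 * e)%R|)%N.
Proof.
pose f b := quad_of_coefs (e - r ^+ 2 - (b - 2 * r) * r, b - 2 * r).
have finj : injective f.
  by move=> b b' /(congr1 (fun u : mquad F => u`_1)); rewrite !quad_of_coefsE /= => /addIr.
have -> : (q - #|sqrts (4 * e)%R|)%N = #|~: sqrts (4 * e)| by rewrite [RHS]cardsCs setCK.
rewrite -(card_imset _ finj); congr #|pred_of_set _|; apply/setP=> u.
have discf b : disc (f b) = b ^+ 2 - 4 * e.
  by rewrite /disc !quad_of_coefsE /=; ring.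
apply/idP/imsetP=> [|[b + ->]].
  rewrite inE horner_quad separable_quad => /andP[du /eqP eu].
  have uf : u = f (u`_1 + 2 * r).
    by apply: quad_eq; rewrite quad_of_coefsE /= -?eu; ring.
  by exists (u`_1 + 2 * r) => //; rewrite !inE -subr_eq0 -discf -uf.
rewrite !inE -subr_eq0 -discf separable_quad => ->; rewrite andTb.
by rewrite horner_quad !quad_of_coefsE /=; apply/eqP; ring.
Qed.

End OddCount.

(** * Counting triples in a finite type *)

Section GenericCounting.
Variables (T : finType).

Lemma card_triples (P1 : pred T) (P2 : T -> pred T) (P3 : T -> T -> pred T) :
  #|[set t : T * T * T | let: (u, v, w) := t in [&& P1 u, P2 u v & P3 u v w]]|
    = \sum_(u | P1 u) \sum_(v | P2 u v) \sum_(w | P3 u v w) 1%N.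
Proof.
rewrite pair_big_dep pair_big_dep /= sum1dep_card; congr #|pred_of_set _|.
by apply/setP=> [[[u v] w]]; rewrite !inE /= andbA.
Qed.

Lemma card_by_value (I : finType) (f : T -> I) (S : {set T}) :
  #|S| = \sum_i #|[set t in S | f t == i]|.
Proof.
rewrite -[LHS]sum1_card (partition_big f predT) //=; apply: eq_bigr => i _.
by rewrite -[RHS]sum1_card; apply: eq_bigl => t; rewrite inE.
Qed.

(** Written as successive removals so that the cardinal is read off one component
    at a time. *)
Definition distinct_triples (S : {set T}) : {set T * T * T} :=
  [set t : T * T * T | let: (u, v, w) := t in
    [&& u \in S, v \in S :\ u & w \in S :\ u :\ v]].

Lemma card_distinct_triples S :
  #|distinct_triples S| = (#|S| * #|S|.-1 * #|S|.-2)%N.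
Proof.
rewrite /distinct_triples (card_triples (fun u => u \in S)
  (fun u v => v \in S :\ u) (fun u v w => w \in S :\ u :\ v)).
rewrite (eq_bigr (fun=> #|S|.-1 * #|S|.-2)%N); first by rewrite sum_nat_const mulnA.
move=> u uS; have cu : #|S :\ u| = #|S|.-1 by rewrite (cardsD1 u S) uS.
rewrite (eq_bigr (fun=> #|S|.-2)); first by rewrite sum_nat_const cu.
by move=> v vS; rewrite sum1_card -cu (cardsD1 v (S :\ u)) vS.
Qed.

End GenericCounting.

(** * Pairwise coprime separable quadratics *)

Section Configurations.
Variable F : finFieldType.
Hypothesis odd_q : odd #|F|.
Implicit Types (u v w : mquad F) (s : seq (mquad F)) (t : triple F).

Local Notation q := #|F|.
Local Notation h := (#|F|./2).

Lemma sum_separable (H : bool -> nat) :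
  (\sum_(u : mquad F | separable_poly u) H (splits u)
    = q * (h * H true + h * H false))%N.
Proof.
rewrite (partition_big (fun u : mquad F => u`_1) predT) //=.
rewrite (eq_bigr (fun=> h * H true + h * H false)%N); first by rewrite sum_nat_const.
by move=> c _; rewrite sum_vertical.
Qed.

Definition compatible s : pred (mquad F) :=
  [pred w : mquad F | separable_poly w && all (fun u : mquad F => coprimep u w) s].

(** The lists of which [compatible s w] describes the one-step extensions, see
    [admissible_rcons]. *)
Definition admissible s :=
  all (fun u : mquad F => separable_poly u) s
  && pairwise (fun u v : mquad F => coprimep u v) s.

Lemma admissible_rcons s w :
  admissible (rcons s w) = admissible s && compatible s w.
Proof.
rewrite /admissible /compatible all_rcons pairwise_rcons /=.
by case: separable_poly; rewrite /= ?andbF // -andbA [all _ _ && pairwise _ _]andbC.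
Qed.

(** Coprime quadratics have disjoint root sets, of size 2 or 0. *)
Lemma card_roots_admissible s : admissible s ->
  #|\bigcup_(u <- s) rts u| = (count (@splits F) s * 2)%N.
Proof.
elim: s => [|u s IH]; first by rewrite big_nil cards0.
case/andP=> /= /andP[su ss] /andP[cu cs]; rewrite big_cons cardsU.
rewrite IH ?card_rts //; last by rewrite /admissible ss.
suff -> : rts u :&: \bigcup_(u <- s) rts u = set0 by rewrite cards0 subn0 mulnDl.
apply/eqP; elim: s cu {IH ss cs} => [|v s IH] /=; first by rewrite big_nil setI0.
rewrite coprimep_quad => /andP[/andP[_ duv] cu].
by rewrite big_cons setIUr setU_eq0 setI_eq0 duv IH.
Qed.

(** A split w differs from any quadratic whose roots it avoids, so that coprimality
    to the whole list is disjointness from the union of the root sets. *)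
Lemma card_compatible_split s : admissible s ->
  #|[set w | compatible s w && splits w]| = 'C(q - count (@splits F) s * 2, 2).
Proof.
move=> ads; rewrite -card_roots_admissible // -(card_split_avoid odd_q).
congr #|pred_of_set _|; apply/setP=> w; rewrite !inE -andbA; congr (_ && _).
rewrite andbC; have [cw /=|//] := boolP (splits w).
elim: s {ads} => [|u s IH] /=; first by rewrite big_nil -setI_eq0 setI0 eqxx.
rewrite big_cons -setI_eq0 setIUr setU_eq0 !setI_eq0 -IH coprimep_quad.
rewrite [in RHS]disjoint_sym; case: eqP => //= ->.
by rewrite -setI_eq0 setIid (negPf cw).
Qed.

(** An irreducible w has no root to share, so that coprimality to the list is just
    non-membership; the irreducible members of the list are distinct since they
    are pairwise coprime. *)
Lemma card_compatible_nonsplit s : admissible s ->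
  #|[set w | compatible s w && ~~ splits w]|
    = (q * h - count (predC (@splits F)) s)%N.
Proof.
move=> /andP[ss cs].
have us : uniq [seq u <- s | predC (@splits F) u].
  apply: filter_uniq; apply: pairwise_uniq cs => u.
  by rewrite coprimep_quad eqxx.
have cI : #|[set w : mquad F | separable_poly w && ~~ splits w]| = (q * h)%N.
  transitivity (\sum_(w : mquad F | separable_poly w) ~~ splits w)%N; last first.
    by rewrite (sum_separable negb) /= muln0 muln1.
  rewrite -sum1_card big_mkcond [RHS]big_mkcond; apply: eq_bigr => w _.
  by rewrite inE; case: separable_poly; case: splits.
set I := [set w : mquad F | separable_poly w && ~~ splits w] in cI.
set J := [set w in [seq u <- s | predC (@splits F) u]].
have <- : #|J| = count (predC (@splits F)) s.
  by rewrite cardsE (card_uniqP us) size_filter.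
rewrite -cI.
have JI : J \subset I.
  apply/subsetP=> w; rewrite !inE mem_filter => /andP[cw ws].
  by apply/andP; split; [exact: (allP ss) | exact: cw].
rewrite -(setIidPr JI) -cardsD; congr #|pred_of_set _|; apply/setP=> w.
rewrite !inE mem_filter /=; have [cw|] := boolP (splits w); first by rewrite !andbF.
rewrite /= !andbT => nw; rewrite andbC; congr (_ && _).
apply/allP/idP=> [cop|wNs u us'].
  by apply/negP=> /cop; rewrite coprimep_quad eqxx.
rewrite coprimep_quad; apply/andP; split; first by apply: contraNneq wNs => <-.
by move: nw; rewrite /splits negbK => /eqP->; rewrite -setI_eq0 setI0.
Qed.

(** The engine of the counts: the number of extensions of an admissible list, of
    each type, depends only on how many of its members are split. *)
Lemma sum_compatible s (H : bool -> nat) : admissible s ->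
  (\sum_(w | compatible s w) H (splits w)
    = 'C(q - count (@splits F) s * 2, 2) * H true
      + (q * h - count (predC (@splits F)) s) * H false)%N.
Proof.
move=> ads; rewrite (bigID (@splits F)) /=; congr addn.
  rewrite (eq_bigr (fun=> H true)) => [|w /andP[_ ->] //].
  by rewrite sum_nat_const -card_compatible_split // cardsE.
rewrite (eq_bigr (fun=> H false)) => [|w /andP[_ /negPf->] //].
by rewrite sum_nat_const -card_compatible_nonsplit // cardsE.
Qed.

Lemma calAE u v w :
  ((u, v, w) \in calA F) = [&& compatible [::] u, compatible [:: u] v
                            & compatible [:: u; v] w].
Proof.
rewrite inE /compatible /= [coprimep w u]coprimep_sym.
case: (separable_poly u) (separable_poly v) (separable_poly w) => [] [] [] //=;
  case: (coprimep u v) (coprimep v w) (coprimep u w) => [] [] [] //.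
Qed.

(** The number of w extending a pair (u, v), where a and b tell whether u and v
    are split. *)
Definition thirds (a b : bool) : nat :=
  'C(q - (a + b) * 2, 2) + (q * h - (~~ a + ~~ b)).

Lemma sum_thirds u v : compatible [::] u -> compatible [:: u] v ->
  (\sum_(w | compatible [:: u; v] w) 1 = thirds (splits u) (splits v))%N.
Proof.
move=> cu cv; have ad : admissible [:: u; v].
  by rewrite -[[:: u; v]]/(rcons (rcons [::] u) v) !admissible_rcons cu cv.
by rewrite (sum_compatible (fun=> 1%N)) //= !muln1 !addn0.
Qed.

Lemma card_calA :
  let seconds (a : bool) := ('C(q - a * 2, 2) * thirds a true
                    + (q * h - ~~ a) * thirds a false)%N in
  #|calA F| = ('C(q, 2) * seconds true + q * h * seconds false)%N.
Proof.
move=> seconds.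
have -> : calA F = [set t | let: (u, v, w) := t in
    [&& compatible [::] u, compatible [:: u] v & compatible [:: u; v] w]].
  by apply/setP=> [[[u v] w]]; rewrite calAE [RHS]inE.
rewrite card_triples.
rewrite (eq_bigr (fun u => seconds (splits u))) => [|u cu].
  by rewrite (sum_compatible seconds (s := [::])) //= mul0n !subn0.
rewrite (eq_bigr (fun v => thirds (splits u) (splits v))) => [|v cv].
  rewrite (sum_compatible (thirds (splits u)) (s := [:: u])) /= ?addn0 //.
  by rewrite -[[:: u]]/(rcons [::] u) admissible_rcons cu.
exact: sum_thirds.
Qed.

(** * Lines of the plane and collinear triples *)

(** Distinct quadratics on a vertical line differ by a nonzero constant. *)
Lemma coprimep_vertical u v : u`_1 = v`_1 -> coprimep u v = (u != v).
Proof.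
move=> e1; rewrite coprimep_quad; case: eqP => //= nuv; apply/pred0P=> x /=.
apply/negP; rewrite !in_rts e1 => /andP[/eqP eu /eqP ev]; case: nuv.
by apply: quad_eq => //; apply: (addrI (x ^+ 2 + v`_1 * x)); rewrite eu ev.
Qed.

(** The difference of two distinct quadratics with the same value at r is a
    multiple of X - r, so that r is their only possible common root. *)
Lemma coprimep_secant u v r : (u : {poly F}).[r] = (v : {poly F}).[r] ->
  coprimep u v = (u != v) && ((u : {poly F}).[r] != 0).
Proof.
rewrite coprimep_quad; have [->|nuv] //= := eqVneq u v.
move=> uvr; apply/pred0P/idP=> [/(_ r)/= /negbT|ur x /=].
  by rewrite /rts !inE !rootE -uvr andbb.
apply: contraNF ur; rewrite !inE !rootE => /andP[/eqP ux /eqP vx].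
suff -> : r = x by rewrite ux.
have n1 : u`_1 - v`_1 != 0.
  apply: contra nuv; rewrite subr_eq0 => /eqP e1; apply/eqP/quad_eq => //.
  by move: uvr; rewrite !horner_quad e1 => /addrI.
apply: (mulfI n1); apply/eqP; rewrite -subr_eq0; apply/eqP.
transitivity (((u : {poly F}).[r] - (v : {poly F}).[r])
              - ((u : {poly F}).[x] - (v : {poly F}).[x])).
  by rewrite !horner_quad; ring.
by rewrite uvr ux vx !subrr.
Qed.

Lemma dd_vertical u v w : u`_1 = v`_1 ->
  dd u v w = (u`_0 - v`_0) * (u`_1 - w`_1).
Proof. by move=> e1; rewrite dd_expand -e1; ring. Qed.

Definition calV : {set triple F} :=
  [set t in calA F | let: (u, v, w) := t in (u`_1 == v`_1) && (w`_1 == u`_1)].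

Lemma card_calV : #|calV| = (q * (h * 2 * (h * 2).-1 * (h * 2).-2))%N.
Proof.
rewrite (card_by_value (fun t => t.1.1`_1)).
rewrite (eq_bigr (fun=> h * 2 * (h * 2).-1 * (h * 2).-2)%N).
  by rewrite sum_nat_const.
move=> c _; pose S := [set u : mquad F | separable_poly u && (u`_1 == c)].
have cS : #|S| = (h * 2)%N.
  rewrite -sum1_card; transitivity (h * 1 + h * 1)%N; last by rewrite -mulnDr.
  rewrite -(sum_vertical odd_q c (fun=> 1%N)); apply: eq_bigl => u.
  by rewrite inE.
rewrite -cS -card_distinct_triples; congr #|pred_of_set _|.
apply/setP=> [[[u v] w]]; rewrite !inE /=.
have [<-|_] := eqVneq u`_1 c; last by rewrite !andbF.
rewrite [v`_1 == _]eq_sym; have [e1|_] := eqVneq u`_1 v`_1; last by rewrite !(andbF, andFb).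
have [e2|_] := eqVneq w`_1 u`_1; last by rewrite !(andbF, andFb).
rewrite (coprimep_vertical e1) (coprimep_vertical e2) coprimep_vertical ?e2 //.
rewrite !andbT [v == u]eq_sym [w == v]eq_sym.
by case: (separable_poly u) (separable_poly v) (separable_poly w) => [] [] [];
  case: (u == v) (w == u) (v == w) => [] [] [].
Qed.

(** Two distinct points of a vertical line are collinear with w only if w lies on
    that line. *)
Lemma dd_eq0_vertical u v w : (u, v, w) \in calA F -> u`_1 = v`_1 ->
  (dd u v w == 0) = (w`_1 == u`_1).
Proof.
rewrite inE => /and5P[_ _ _ cuv _] e1; rewrite (dd_vertical _ e1) mulf_eq0 !subr_eq0.
rewrite [w`_1 == _]eq_sym; case: eqP => // e0.
by move: cuv; rewrite coprimep_quad (quad_eq e0 e1) eqxx.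
Qed.

(** The line through u and v, when it is not vertical, is u(r) = e for this r and
    the common value e of u and v at r. *)
Definition secant_root u v : F := (u`_0 - v`_0) / (v`_1 - u`_1).

Lemma secant_rootP u v r : u`_1 != v`_1 ->
  ((u : {poly F}).[r] == (v : {poly F}).[r]) = (secant_root u v == r).
Proof.
rewrite eq_sym -subr_eq0 => n1; rewrite /secant_root -[RHS](inj_eq (mulIf n1)) divfK //.
rewrite -subr_eq0 -[RHS]subr_eq0; congr (_ == _).
by rewrite !horner_quad; ring.
Qed.

Definition calN : {set triple F} :=
  [set t in calD F | let: (u, v, w) := t in u`_1 != v`_1].

(** A nonvertical collinear triple determines its line, and on a line u(r) = e with
    e nonzero every triple of distinct separable quadratics occurs. *)
Lemma calN_fiber r e (S := [set u : mquad F | separable_poly u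
                                   && ((u : {poly F}).[r] == e)]) :
  e != 0 ->
  [set t in calN | (secant_root t.1.1 t.1.2, (t.1.1 : {poly F}).[secant_root t.1.1 t.1.2])
     == (r, e)] = distinct_triples S.
Proof.
move=> e0; apply/setP=> [[[u v] w]]; apply/idP/idP.
  rewrite !inE /= xpair_eqE => /andP[/andP[/andP[]]].
  move=> /and5P[-> -> -> cuv /andP[cvw cwu]] dd0 n1 /andP[rE].
  rewrite (eqP rE) => ue.
  have uv := rE; rewrite -secant_rootP // (eqP ue) eq_sym in uv.
  rewrite ue uv /=; have we : (w : {poly F}).[r] == e.
    have n1' : v`_1 - u`_1 != 0 by rewrite subr_eq0 eq_sym.
    rewrite -subr_eq0 -(inj_eq (mulfI n1')) mulr0 -(eqP ue); apply/eqP.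
    rewrite -[RHS]oppr0 -[in RHS](eqP dd0) dd_expand !horner_quad -(eqP rE) /secant_root.
    by field.
  rewrite we /=; move: cuv cvw cwu; rewrite !coprimep_quad.
  by move=> /andP[nuv _] /andP[nvw _] /andP[-> _]; rewrite eq_sym nuv eq_sym nvw.
rewrite !inE => /and3P[/andP[su ue] /and3P[nvu sv ve] /and4P[nwv nwu sw we]].
have uv : (u : {poly F}).[r] = (v : {poly F}).[r] by rewrite (eqP ue) (eqP ve).
have vw : (v : {poly F}).[r] = (w : {poly F}).[r] by rewrite (eqP we) (eqP ve).
have wu : (w : {poly F}).[r] = (u : {poly F}).[r] by rewrite (eqP we) (eqP ue).
have n1 : u`_1 != v`_1.
  apply: contraNneq nvu => e1; apply/eqP/quad_eq => //.
  by move: uv; rewrite !horner_quad e1 => /addrI.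
have rE : secant_root u v = r by apply/eqP; rewrite -secant_rootP // uv.
rewrite /= su sv sw (coprimep_secant uv) (coprimep_secant vw) (coprimep_secant wu).
rewrite (eqP ue) (eqP ve) (eqP we) e0 eq_sym nvu eq_sym nwv nwu n1 rE (eqP ue) eqxx.
rewrite !andbT /= dd_expand.
have c0 (z : mquad F) : (z : {poly F}).[r] == e -> z`_0 = e - r ^+ 2 - z`_1 * r.
  by move/eqP<-; rewrite horner_quad; ring.
by apply/eqP; rewrite (c0 u) // (c0 v) // (c0 w) //; ring.
Qed.

(** The sum over the lines u(r) = e: those with e = 0 contribute nothing, and the
    others have q - 2 or q separable points according as e is a square or not. *)
Lemma card_calN :
  #|calN| = (q * (h * ((q - 2) * (q - 2).-1 * (q - 2).-2) + h * (q * q.-1 * q.-2)))%N.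
Proof.
rewrite (card_by_value (fun t => (secant_root t.1.1 t.1.2,
   (t.1.1 : {poly F}).[secant_root t.1.1 t.1.2]))).
pose k (a : bool) := ((q - a * 2) * (q - a * 2).-1 * (q - a * 2).-2)%N.
transitivity (\sum_(p : F * F | p.2 != 0%R) k (is_square p.2))%N.
  rewrite [RHS]big_mkcond; apply: eq_bigr => [[r e]] _ /=.
  have [->|e0] := eqVneq e 0 => /=.
    apply: eq_card0 => [[[u v] w]]; rewrite !inE /= xpair_eqE.
    apply/negP=> /andP[/andP[/andP[/and5P[_ _ _ cuv _] _] n1] /andP[rE ue]].
    have uv : (u : {poly F}).[secant_root u v] = (v : {poly F}).[secant_root u v].
      by apply/eqP; rewrite secant_rootP.
    by move: cuv; rewrite (coprimep_secant uv) ue andbF.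
  (* The line count involves 4e, which is a square exactly when e is. *)
  have e4 : 4 * e != 0 by rewrite mulf_neq0 ?four_neq0.
  rewrite calN_fiber // card_distinct_triples card_line // card_sqrts //.
  rewrite /k; suff -> : is_square (4 * e) = is_square e by [].
  apply/set0Pn/set0Pn=> [] [x]; rewrite inE => /eqP xe.
    exists (x / 2); rewrite inE expr_div_n xe (_ : 2 ^+ 2 = 4 :> F); last by ring.
    by rewrite mulrC mulKf // four_neq0.
  by exists (2 * x); rewrite inE exprMn xe; apply/eqP; ring.
rewrite -(pair_big_dep xpredT (fun _ e => e != 0) (fun _ e => k (is_square e))) /=.
rewrite (eq_bigr (fun=> h * k true + h * k false)%N).
  by rewrite sum_nat_const /k mul1n mul0n subn0.
by move=> r _; rewrite sum_nonzero_by_square.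
Qed.

Lemma calD_split : calD F = calV :|: calN.
Proof.
apply/setP=> [[[u v] w]].
have inD : ((u, v, w) \in calD F) = ((u, v, w) \in calA F) && (dd u v w == 0).
  by rewrite inE.
have inV : ((u, v, w) \in calV)
    = ((u, v, w) \in calA F) && ((u`_1 == v`_1) && (w`_1 == u`_1)).
  by rewrite inE.
have inN : ((u, v, w) \in calN) = ((u, v, w) \in calD F) && (u`_1 != v`_1).
  by rewrite inE.
rewrite in_setU inV inN inD.
have [tA|] //= := boolP ((u, v, w) \in calA F).
have [e1|_] := eqVneq u`_1 v`_1; last by rewrite andbT.
by rewrite andbF orbF dd_eq0_vertical.
Qed.

Lemma card_calD : #|calD F| = (#|calV| + #|calN|)%N.
Proof.
rewrite calD_split cardsU (_ : _ :&: _ = set0) ?cards0 ?subn0 //.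
apply/setP=> [[[u v] w]]; rewrite in_setI in_set0; apply/negP=> /andP[].
rewrite inE => /andP[_ /andP[uv _]].
by rewrite inE => /andP[_]; rewrite uv.
Qed.

(** * Triples with a vertical pair *)

(** For u of type a the vertical line through u has h - a further split points
    and h - ~~a further irreducible ones, all coprime to u. *)
Lemma card_vertical_pairs :
  let pairs (a : bool) := ((h - a) * thirds a true + (h - ~~ a) * thirds a false)%N in
  #|[set t in calA F | t.1.1`_1 == t.1.2`_1]| = (q * (h * pairs true + h * pairs false))%N.
Proof.
move=> pairs.
have -> : [set t in calA F | t.1.1`_1 == t.1.2`_1] = [set t | let: (u, v, w) := t in
    [&& compatible [::] u, compatible [:: u] v && (u`_1 == v`_1)
      & compatible [:: u; v] w]].
  apply/setP=> [[[u v] w]];  rewrite [LHS]inE [RHS]inE calAE -!andbA /=; congr (_ && (_ && _)).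
  by rewrite /compatible /= andbT; case: (_ == _); rewrite ?andbT ?andbF.
rewrite (card_triples (compatible [::])
  (fun u v => compatible [:: u] v && (u`_1 == v`_1)) (fun u v => compatible [:: u; v])).
rewrite -sum_separable.
rewrite (eq_bigl (fun u : mquad F => separable_poly u)); last first.
  by move=> u; rewrite /compatible /= andbT.
apply: eq_bigr => u su.
have cu : compatible [::] u by rewrite /compatible /= su.
rewrite (eq_bigr (fun v => thirds (splits u) (splits v))); last first.
  by move=> v /andP[cv _]; apply: sum_thirds.
have := sum_vertical odd_q u`_1 (thirds (splits u)).
rewrite (bigD1 u) /= ?su ?eqxx // => sumE.
apply: (@addnI (thirds (splits u) (splits u))); rewrite /pairs.
have h0 : (0 < h)%N by rewrite half_gt0; apply: finNzRing_gt1.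
have -> : (thirds (splits u) (splits u) + ((h - splits u) * thirds (splits u) true
   + (h - ~~ splits u) * thirds (splits u) false)
   = h * thirds (splits u) true + h * thirds (splits u) false)%N.
  by case: (splits u) => /=; nia.
rewrite -sumE; congr addn; apply: eq_bigl => v.
rewrite /compatible /= andbT -!andbA [v == u]eq_sym [v`_1 == _]eq_sym.
congr (_ && _); case: eqP => [e1|_]; last by rewrite andbF.
by rewrite andbT coprimep_vertical.
Qed.

Definition calT : {set triple F} :=
  [set t in calA F | let: (u, v, w) := t in (u`_1 == v`_1) && (w`_1 != u`_1)].

Lemma card_calT :
  (#|calT| + #|calV|)%N = #|[set t in calA F | t.1.1`_1 == t.1.2`_1]|.
Proof.
set S := [set t in calA F | _].
have inS u v w : ((u, v, w) \in S) = ((u, v, w) \in calA F) && (u`_1 == v`_1).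
  by rewrite inE.
have inV u v w : ((u, v, w) \in calV)
    = ((u, v, w) \in calA F) && ((u`_1 == v`_1) && (w`_1 == u`_1)) by rewrite inE.
have inT u v w : ((u, v, w) \in calT)
    = ((u, v, w) \in calA F) && ((u`_1 == v`_1) && (w`_1 != u`_1)) by rewrite inE.
rewrite addnC -(cardsID calV S).
congr addn; congr #|pred_of_set _|; apply/setP=> [[[u v] w]].
  rewrite in_setI inS inV.
  by case: (_ \in calA F) (u`_1 == v`_1) => [] [].
rewrite in_setD inS inV inT andbC.
by case: (_ \in calA F) (u`_1 == v`_1) => [] [] //=; rewrite andbF.
Qed.

Definition cycle3 t : triple F := let: (u, v, w) := t in (v, w, u).

Lemma cycle3_bij : bijective cycle3.
Proof. by exists (cycle3 \o cycle3) => -[[u v] w]. Qed.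

Lemma cycle3_calA t : (cycle3 t \in calA F) = (t \in calA F).
Proof.
case: t => [[u v] w]; rewrite !inE /=.
case: (separable_poly u) (separable_poly v) (separable_poly w) => [] [] [] //=.
by rewrite andbA andbC.
Qed.

(** Off D at most one of the three equalities holds, because two of them force the
    third; conversely one equality without the others gives d <> 0. *)
Lemma calG5_cycles :
  calG5 F = calT :|: (cycle3 @^-1: calT :|: cycle3 @^-1: (cycle3 @^-1: calT)).
Proof.
have inC (S : {set triple F}) t : (t \in cycle3 @^-1: S) = (cycle3 t \in S).
  by rewrite inE.
apply/setP=> [[[u v] w]]; rewrite !in_setU !inC /cycle3.
have inT (a b c : mquad F) : ((a, b, c) \in calT)
   = ((a, b, c) \in calA F) && ((a`_1 == b`_1) && (c`_1 != a`_1)) by rewrite inE.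
have -> : ((u, v, w) \in calG5 F) = ((u, v, w) \in calA F)
   && ((dd u v w != 0) && [|| u`_1 == v`_1, v`_1 == w`_1 | w`_1 == u`_1]).
  by rewrite inE.
rewrite !inT; have cA := cycle3_calA (u, v, w); have cA' := cycle3_calA (v, w, u).
rewrite /= in cA cA'; rewrite cA' cA; have [tA|] //= := boolP ((u, v, w) \in calA F).
rewrite tA in cA; rewrite cA in cA'.
have ddC : dd u v w = dd v w u by rewrite !dd_expand; ring.
have ddC' : dd u v w = dd w u v by rewrite !dd_expand; ring.
have [e1|n1] := eqVneq u`_1 v`_1.
  rewrite (dd_eq0_vertical tA e1) /= andbT -e1 [u`_1 == w`_1]eq_sym.
  by case: eqP; rewrite //= eqxx.
have [e2|n2] := eqVneq v`_1 w`_1.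
  by rewrite ddC (dd_eq0_vertical cA e2) /= andbT n1.
have [e3|n3] /= := eqVneq w`_1 u`_1; last by rewrite andbF.
by rewrite ddC' (dd_eq0_vertical cA' e3) andbT.
Qed.

Lemma card_calG5 : #|calG5 F| = (3 * #|calT|)%N.
Proof.
rewrite calG5_cycles; set A := cycle3 @^-1: calT; set B := cycle3 @^-1: A.
have cA : #|A| = #|calT| by apply: on_card_preimset; apply: onW_bij cycle3_bij.
have cB : #|B| = #|calT|.
  by rewrite -cA; apply: on_card_preimset; apply: onW_bij cycle3_bij.
have dAB : A :&: B = set0.
  apply/setP=> [[[u v] w]]; rewrite !inE; apply/negP=> /=.
  by case/andP=> /and3P[_ /eqP e n] /and3P[_ /eqP e' n']; rewrite e e' eqxx in n.
have dT : calT :&: (A :|: B) = set0.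
  apply/setP=> [[[u v] w]]; rewrite !inE; apply/negP=> /=.
  case/andP=> /and3P[_ /eqP e n] /orP[] /and3P[_ /eqP e' n'].
    by rewrite e eqxx in n'.
  by rewrite e' eqxx in n.
by rewrite cardsU dT cardsU dAB cards0 !subn0 cA cB mulSn mulSn mul1n.
Qed.

Lemma card_calG6 : (#|calD F| + #|calG5 F| + #|calG6 F|)%N = #|calA F|.
Proof.
have dDG : calD F :&: calG5 F = set0.
  apply/setP=> [[[u v] w]]; rewrite in_setI [X in X && _]inE [X in _ && X]inE in_set0.
  by case: (dd u v w == 0); rewrite ?andbF.
have sDG : calD F :|: calG5 F \subset calA F.
  by rewrite subUset; apply/andP; split; apply/subsetP=> t; rewrite inE => /andP[].
rewrite -[RHS](cardsID (calD F :|: calG5 F)) (setIidPr sDG) cardsU dDG cards0.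
by rewrite subn0.
Qed.

End Configurations.

(** * Orbits, stability and stabilisers *)

Section Orbits.
Variable F : finFieldType.
Implicit Types (u v w : mquad F) (t : triple F) (g : aff F) (X : {set triple F}).

Lemma mem_orbits X O : O \in aff_orbits X ->
  exists2 t, t \in X & O = orbit (aff_act F) [set: aff F] t.
Proof. by case/imsetP=> t tX ->; exists t. Qed.

Lemma card_orbit_stab_order X O : O \in aff_orbits X ->
  (#|O| * stab_order O)%N = #|[set: aff F]|.
Proof.
move=> /mem_orbits[t _ ->]; rewrite (stab_orderE (orbit_refl _ _ _)).
by rewrite card_orbit_in_stab ?subsetT.
Qed.

(** Orbit-stabiliser turns 1 / #Stab into #O / #Aff. *)
Lemma mass_card X : aff_stable X -> mass X = #|X|%:R / #|[set: aff F]|%:R.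
Proof.
move=> actX; rewrite -(acts_sum_card_orbit actX) natr_sum mulr_suml.
apply: eq_bigr => O OX; have cO := card_orbit_stab_order OX.
have : (0 < #|[set: aff F]|)%N by rewrite cardG_gt0.
rewrite -cO muln_gt0 => /andP[O0 s0]; rewrite natrM; field.
by rewrite !pnatr_eq0 -!lt0n O0 s0.
Qed.

Lemma stableI X : (forall t g, t \in X -> triple_act t g \in X) -> aff_stable X.
Proof.
move=> actX; apply/actsP=> g _ t; apply/idP/idP; last exact: actX.
by move/(actX _ g^-1%g); rewrite -triple_actM mulgV triple_act1.
Qed.

Lemma mquad_act_inj g : injective (fun u => mquad_act u g).
Proof.
apply: (can_inj (g := fun u => mquad_act u g^-1%g)) => u.
by rewrite -mquad_actM mulgV mquad_act1.
Qed.

Lemma coprimep_act u v g :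
  coprimep u v -> coprimep (mquad_act u g) (mquad_act v g).
Proof.
rewrite !coprimep_quad (inj_eq (@mquad_act_inj g)) => /andP[-> /pred0P dR] /=.
by apply/pred0P=> x /=; rewrite !act_rts; apply: dR.
Qed.

Lemma act_coef1_eq u v g :
  ((mquad_act u g)`_1 == (mquad_act v g)`_1) = (u`_1 == v`_1).
Proof.
have a0 : (val (aff_a g))^-1 != 0 by rewrite invr_eq0 aff_a_neq0.
by rewrite !act_coefs (inj_eq (mulIf a0)) (inj_eq (addrI _)).
Qed.

Lemma dd_act u v w g :
  (dd (mquad_act u g) (mquad_act v g) (mquad_act w g) == 0) = (dd u v w == 0).
Proof.
have a0 := aff_a_neq0 g; set L := dd _ _ _.
have -> : L = (val (aff_a g) ^+ 3)^-1 * dd u v w.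
  by rewrite /L !dd_expand !act_coefs; field.
by rewrite mulf_eq0 invr_eq0 expf_eq0 (negPf a0).
Qed.

Hypothesis odd_q : odd #|F|.
Local Notation q := #|F|.
Local Notation h := (#|F|./2).

Lemma separable_act u g : separable_poly (mquad_act u g) = separable_poly u.
Proof.
have a0 := aff_a_neq0 g.
by rewrite !separable_quad // disc_act mulf_eq0 invr_eq0 expf_eq0 (negPf a0) orbF.
Qed.

Lemma calA_act t g : t \in calA F -> triple_act t g \in calA F.
Proof.
case: t => [[u v] w]; rewrite !inE /= !separable_act.
by case/and5P=> -> -> -> cuv /andP[cvw cwu]; rewrite !coprimep_act.
Qed.

Lemma stable_calA : aff_stable (calA F).
Proof. by apply: stableI => t g; apply: calA_act. Qed.

Lemma stable_calD : aff_stable (calD F).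
Proof.
apply: stableI => -[[u v] w] g; rewrite inE => /andP[tA tD].
by rewrite inE (calA_act g tA) /= dd_act.
Qed.

Lemma stable_calV : aff_stable (calV F).
Proof.
apply: stableI => -[[u v] w] g; rewrite inE => /andP[tA tV].
by rewrite inE (calA_act g tA) /= !act_coef1_eq.
Qed.

Lemma stable_calG5 : aff_stable (calG5 F).
Proof.
apply: stableI => -[[u v] w] g; rewrite inE => /andP[tA tG].
by rewrite inE (calA_act g tA) /= dd_act !act_coef1_eq.
Qed.

Lemma stable_calG6 : aff_stable (calG6 F).
Proof.
apply/actsP=> g gG t; rewrite !in_setD !in_setU.
by rewrite (actsP stable_calA) // (actsP stable_calD) // (actsP stable_calG5).
Qed.

Fact unitN1 : (-1 : F) \is a GRing.unit. Proof. exact: unitrN1. Qed.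

(** The map x -> -x - c; for c = u_1 it exchanges the roots of u. *)
Definition reflection (c : F) : aff F := Aff (FinRing.unit F unitN1) (- c).

Lemma reflection_inj : injective reflection.
Proof. by move=> c d /(congr1 (@aff_b F)) /= /oppr_inj. Qed.

Lemma reflection_neq1 c : reflection c != 1%g.
Proof.
apply/eqP=> /(congr1 (fun g => val (aff_a g))) /= /eqP.
by rewrite eq_sym -subr_eq0 opprK (negPf (two_neq0 odd_q)).
Qed.

(** Comparing discriminants gives a^2 = 1, and comparing linear coefficients then
    determines b. *)
Lemma fixed_quad u g : separable_poly u ->
  (mquad_act u g == u) = (g == 1%g) || (g == reflection u`_1).
Proof.
rewrite separable_quad // => du; apply/eqP/orP=> [fix_u|].
  have a0 := aff_a_neq0 g.
  have e1 : 2 * aff_b g + u`_1 = u`_1 * val (aff_a g).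
    by rewrite -{2}fix_u act_coefs divfK.
  have : val (aff_a g) ^+ 2 == 1.
    apply/eqP/(mulfI du); rewrite mulr1 -{1}fix_u disc_act divfK //.
    by rewrite expf_eq0 (negPf a0).
  rewrite sqrf_eq1 => /orP[] /eqP ea; [left | right]; apply/eqP.
    have b0 : aff_b g = 0.
      apply: (mulfI (two_neq0 odd_q)); apply: (addIr u`_1).
      by rewrite e1 ea; ring.
    by case: g ea b0 {e1 a0 fix_u} => a b /= ea ->; congr Aff; apply: val_inj.
  have bE : aff_b g = - u`_1.
    apply: (mulfI (two_neq0 odd_q)); apply: (addIr u`_1).
    by rewrite e1 ea; ring.
  by case: g ea bE {e1 a0 fix_u} => a b /= ea ->; congr Aff; apply: val_inj.
case=> /eqP ->; first exact: mquad_act1.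
apply: quad_eq; rewrite act_coefs /= ?sqrrN ?expr1n ?invrN invr1; by ring.
Qed.

(** The reflections attached to u, v, w agree exactly when u_1 = v_1 = w_1. *)
Lemma card_stab t : t \in calA F ->
  #|'C_[set: aff F][t | aff_act F]%g| = (t \in calV F).+1.
Proof.
case: t => [[u v] w] tA.
have [su sv sw] : [/\ separable_poly u, separable_poly v & separable_poly w].
  by move: tA; rewrite inE => /and4P[].
have inC g : (g \in 'C_[set: aff F][(u, v, w) | aff_act F]%g)
    = (g == 1%g) || ((u, v, w) \in calV F) && (g == reflection u`_1).
  rewrite inE in_setT /= (sameP astab1P eqP) /= !xpair_eqE.
  have inV : ((u, v, w) \in calV F) = (u`_1 == v`_1) && (w`_1 == u`_1).
    by rewrite inE tA.
  rewrite !fixed_quad // inV.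
  have [->|_] //= := eqVneq g 1%g.
  have [->|_] /= := eqVneq g (reflection u`_1); last by rewrite andbF.
  rewrite andbT !(inj_eq (@reflection_inj)) [w`_1 == _]eq_sym //.
have [tV|tV] := boolP (_ \in calV F).
  rewrite (_ : 'C__[_|_]%g = [set 1%g; reflection u`_1]) ?cards2.
    by rewrite eq_sym reflection_neq1.
  by apply/setP=> g; rewrite inC tV !inE.
rewrite (_ : 'C__[_|_]%g = [set 1%g]) ?cards1 //.
by apply/setP=> g; rewrite inC (negPf tV) orbF inE.
Qed.

Lemma stab_order_orbit t : t \in calA F ->
  stab_order (orbit (aff_act F) [set: aff F] t) = (t \in calV F).+1.
Proof. by move=> tA; rewrite (stab_orderE (orbit_refl _ _ _)) card_stab. Qed.

Lemma orbits_nontrivial_stab :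
  [set O in aff_orbits (calA F) | stab_order O != 1%N] = aff_orbits (calV F).
Proof.
have VA : calV F \subset calA F by apply/subsetP=> t; rewrite inE => /andP[].
apply/setP=> O; rewrite inE; apply/andP/idP=> [[/mem_orbits[t tA ->]]|].
  by rewrite stab_order_orbit //; case tV: (t \in calV F) => // _; apply: imset_f.
case/mem_orbits=> t tV ->; have tA := subsetP VA _ tV.
by rewrite stab_order_orbit // tV; split=> //; apply: imset_f.
Qed.

(** Every orbit of V contributes 1/2 to the mass. *)
Lemma N_stab_mass : (N_stab (calA F))%:R = 2 * mass (calV F).
Proof.
rewrite /N_stab orbits_nontrivial_stab /mass mulr_sumr -sum1_card natr_sum.
apply: eq_bigr => O; rewrite -orbits_nontrivial_stab inE.
case/andP=> /mem_orbits[t tA ->]; rewrite stab_order_orbit //.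
by case: (t \in calV F) => // _; rewrite divff.
Qed.

(** An orbit counts 1: its mass, plus the missing 1/2 when the stabiliser has
    order 2. *)
Lemma N_orb_mass : (N_orb (calA F))%:R = mass (calA F) + (N_stab (calA F))%:R / 2.
Proof.
rewrite /N_stab /N_orb -!sum1_card !natr_sum mulr_suml.
rewrite [X in _ + X](eq_bigl (fun O => (O \in aff_orbits (calA F))
  && (stab_order O != 1%N))); last by move=> O; rewrite inE.
rewrite big_mkcondr /mass -big_split /=; apply: eq_bigr => O.
case/mem_orbits=> t tA ->; rewrite stab_order_orbit //.
by case: (t \in calV F).
Qed.

Lemma nontrivial_stab_calD O :
  O \in aff_orbits (calA F) -> stab_order O != 1%N -> O \subset calD F.
Proof.
move=> OA sO; have : O \in aff_orbits (calV F).
  by rewrite -orbits_nontrivial_stab inE OA.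
case/mem_orbits=> t tV ->; rewrite acts_sub_orbit; last exact: stable_calD.
by rewrite calD_split in_setU tV.
Qed.

End Orbits.

(** * The masses *)

Section Masses.
Variable F : finFieldType.
Hypothesis odd_q : odd #|F|.
Local Notation q := (#|F|%:R : rat).

(** With truncated subtraction the identity also covers the degenerate case k < j,
    where both sides vanish. *)
Lemma bin2_odd k j : 'C((k * 2).+1 - j * 2, 2) = (((k - j) * 2 + 1) * (k - j))%N.
Proof.
have [jk|kj] := leqP j k.
  have -> : ((k * 2).+1 - j * 2 = ((k - j) * 2).+1)%N by lia.
  by rewrite bin2odd /= muln2 ?odd_double // doubleK addn1.
have [-> ->] : (k - j = 0 /\ (k * 2).+1 - j * 2 = 0)%N by lia.
by [].
Qed.

Lemma third_descending_natr m :
  (m * m.-1 * m.-2)%:R = m%:R * (m%:R - 1) * (m%:R - 2) :> rat.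
Proof. by case: m => [|[|m]]; rewrite /= ?mulr0n ?natrM -?natr1; ring. Qed.

(** The values free of truncated subtraction, valid for q >= 5; with q = 2m + 5
    they turn the cardinals into polynomials in m. *)
Lemma thirds_values m : #|F| = (m.+2 * 2).+1 ->
  [/\ thirds F true true = ((m * 2 + 1) * m + (m * 2 + 5) * (m + 2))%N,
      thirds F true false = ((m * 2 + 3) * (m + 1) + (2 * m * m + 9 * m + 9))%N,
      thirds F false true = ((m * 2 + 3) * (m + 1) + (2 * m * m + 9 * m + 9))%N
    & thirds F false false = ((m * 2 + 5) * (m + 2) + (2 * m * m + 9 * m + 8))%N].
Proof.
move=> qE; have hE : #|F|./2 = m.+2 by rewrite qE; lia.
by split; rewrite /thirds hE qE bin2_odd /=; nia.
Qed.

(** For q = 3 some of the subtractions in the counts truncate, and the counts are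
    evaluated outright. *)
Lemma odd_card_cases :
  #|F| = 3%N \/ exists m, #|F| = (m.+2 * 2).+1 /\ #|F|./2 = m.+2.
Proof.
have h0 : (0 < #|F|./2)%N by rewrite half_gt0; apply: finNzRing_gt1.
have := card_odd_field odd_q; move: h0.
by case: (#|F|./2) => [|[|m]] // _ e; [left | right; exists m].
Qed.

Lemma mass_of_card (X : {set triple F}) (c : rat) : aff_stable X ->
  #|X|%:R = q * (q - 1) * c -> mass X = c.
Proof.
move=> sX cX; have q1 : (1 < #|F|)%N by apply: finNzRing_gt1.
rewrite mass_card // cX card_aff natrM -subn1 natrB 1?ltnW //.
have q0 : q != 0 by rewrite pnatr_eq0 -lt0n ltnW.
have q10 : q - 1 != 0 by rewrite subr_eq0 (eqr_nat _ _ 1) gtn_eqF.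
by field; rewrite q0 q10.
Qed.

Lemma mass_calV : mass (calV F) = (q - 2) * (q - 3).
Proof.
apply: mass_of_card; first exact: stable_calV.
have e : (#|F|./2 * 2)%:R = q - 1.
  by apply/eqP; rewrite eq_sym subr_eq natr1 -card_odd_field.
by rewrite card_calV // natrM third_descending_natr e; ring.
Qed.

Lemma mass_calA : mass (calA F) = (q - 2) ^+ 2 * (q ^+ 2 - q + 4).
Proof.
apply: mass_of_card; first exact: stable_calA.
rewrite card_calA //; have [qE|[m [qE hE]]] := odd_card_cases.
  rewrite /thirds qE; set N := (X in X%:R = _); rewrite (_ : N = 60%N) //; ring.
have [-> -> -> ->] := thirds_values qE; rewrite hE qE.
have -> : 'C((m.+2 * 2).+1, 2) = (((m.+2 - 0) * 2 + 1) * (m.+2 - 0))%N.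
  by rewrite -bin2_odd mul0n subn0.
rewrite !bin2_odd /=.
have -> : (m.+2 - 0 = m + 2)%N by lia.
have -> : (m.+2 - 1 = m + 1)%N by lia.
have -> : ((m.+2 * 2).+1 * m.+2 - 1 = 2 * m * m + 9 * m + 9)%N by nia.
have -> : ((m.+2 * 2).+1 * m.+2 - 0 = 2 * m * m + 9 * m + 10)%N by nia.
ring.
Qed.

Lemma mass_calD : mass (calD F) = (q - 2) * (q ^+ 2 - 3 * q + 3).
Proof.
apply: mass_of_card; first exact: stable_calD.
have q1 : (1 < #|F|)%N by apply: finNzRing_gt1.
have e : (#|F|./2 * 2)%:R = q - 1.
  by apply/eqP; rewrite eq_sym subr_eq natr1 -card_odd_field.
have e2 : #|F|./2%:R = (q - 1) / 2 by rewrite -e natrM mulfK.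
rewrite card_calD // card_calV // card_calN //.
move: (third_descending_natr (#|F|./2 * 2)) (third_descending_natr (#|F| - 2)).
move: (third_descending_natr #|F|).
set a := (#|F| * _ * _)%N; set b := (#|F|./2 * 2 * _ * _)%N; set c := ((#|F| - 2) * _ * _)%N.
move: a b c => a b c ea eb ec.
by rewrite natrD !natrM natrD !natrM ea eb ec e e2 natrB //; field.
Qed.

Lemma mass_calG5 : mass (calG5 F) = 3 * (q ^+ 3 - 6 * q ^+ 2 + 14 * q - 13).
Proof.
apply: mass_of_card; first exact: stable_calG5.
rewrite card_calG5 // natrM; have := card_calT F; rewrite card_vertical_pairs //.
rewrite card_calV //; have [qE|[m [qE hE]]] := odd_card_cases.
  rewrite /thirds qE; set N := (X in _ = X -> _); rewrite (_ : N = 12%N) //.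
  by rewrite addn0 => ->; ring.
have [-> -> -> ->] := thirds_values qE; rewrite hE qE /= => cT.
(* This is q (q - 1) (q^3 - 6 q^2 + 14 q - 13) at q = 2m + 5. *)
suff -> : #|calT F| = ((m.+2 * 2).+1 * (m.+2 * 2) * (8 * m ^ 3 + 36 * m ^ 2 + 58 * m + 32))%N.
  ring.
apply: (@addIn ((m.+2 * 2).+1 * (m.+2 * 2 * (m.+1 * 2).+1 * (m.+1 * 2)))); rewrite cT.
have [-> ->] : (m.+2 - 1 = m + 1 /\ m.+2 - 0 = m + 2)%N by lia.
ring.
Qed.

Lemma mass_split : mass (calA F) = mass (calD F) + mass (calG5 F) + mass (calG6 F).
Proof.
have sA := stable_calA odd_q; have sD := stable_calD odd_q.
have sG5 := stable_calG5 odd_q; have sG6 := stable_calG6 odd_q.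
by rewrite !mass_card // -!mulrDl -!natrD card_calG6.
Qed.

End Masses.

Theorem theorem7p5 (F : finFieldType) (n : nat)
    (cardF : #|F| = n) (n_odd : odd n) (n_ge3 : (3 <= n)%N) :
  let q : rat := n%:R in
  [/\ (forall X : {set triple F}, X \subset calA F -> aff_stable X ->
         mass X = #|X|%:R / #|[set: aff F]|%:R),
      [/\ mass (calA F) = (q - 2) ^+ 2 * (q ^+ 2 - q + 4),
          mass (calD F) = (q - 2) * (q ^+ 2 - 3 * q + 3),
          mass (calG5 F) = 3 * (q ^+ 3 - 6 * q ^+ 2 + 14 * q - 13),
          mass (calG6 F) = q ^+ 4 - 9 * q ^+ 3 + 35 * q ^+ 2 - 71 * q + 61
        & mass (calA F) = mass (calD F) + mass (calG5 F) + mass (calG6 F)],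
      (N_orb (calA F))%:R
        = (q - 2) ^+ 2 * (q ^+ 2 - q + 4) + (q - 2) * (q - 3),
      (N_stab (calA F))%:R = 2 * (q - 2) * (q - 3)
    & (forall O : {set triple F}, O \in aff_orbits (calA F) ->
         stab_order O != 1%N -> O \subset calD F)].
Proof.
move=> q; have odd_q : odd #|F| by rewrite cardF.
have qE : #|F|%:R = q by rewrite cardF.
have mA := mass_calA odd_q; have mD := mass_calD odd_q.
have mG5 := mass_calG5 odd_q; have mG := mass_split odd_q.
have mV := mass_calV odd_q; rewrite qE in mA mD mG5 mV.
have nS : (N_stab (calA F))%:R = 2 * (q - 2) * (q - 3).
  by rewrite N_stab_mass // mV mulrA.
split=> //; first by move=> X _; apply: mass_card.
- split=> //; apply: (addrI (mass (calD F) + mass (calG5 F))).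
  by rewrite -mG mA mD mG5; ring.
- by rewrite N_orb_mass // nS mA; field.
- exact: nontrivial_stab_calD.
Qed.
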